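(* Let $L\ge 4$ be even, $A=\{1,L,L+1\}$, and let $n,d,e\in\mathbb{N}$ be such that both players are middle class, i.e. $M_1(n)\le d<U_1(n)$ and $M_2(n)\le e<U_2(n)$. Then the winner of $\mathrm{NIM}(A;n;d,e)$ is determined as follows. 1. $n\equiv 0,2,4,\dots,L-2,\,L+2,L+4,L+6,\dots,2L-2\pmod{2L}$: - if $d<M_1(n)+\frac L2-1$, then $W(n;d,e)=2$; - for every integer $k\ge 1$, if $M_1(n)+\frac{Lk}{2}-1\le d<M_1(n)+\frac{L(k+1)}{2}-1$, then $W(n;d,e)=1$ when $e<M_2(n)+\frac{Lk}{2}$, and $W(n;d,e)=2$ when $e\ge M_2(n)+\frac{Lk}{2}$; - if $d\ge U_1(n)-\frac L2$, then $W(n;d,e)=1$ when $e<U_2(n)-\frac L2$, and $W(n;d,e)=2$ when $e\ge U_2(n)-\frac L2$. 2. $n\equiv 1,3,5,\dots,2L-1\pmod{2L}$: - for every integer $k\ge 0$, if $M_1(n)+\frac{Lk}{2}\le d<M_1(n)+\frac{L(k+1)}{2}$, then $W(n;d,e)=1$ when $e<M_2(n)+\frac{L(k+1)}{2}-1$, and $W(n;d,e)=2$ when $e\ge M_2(n)+\frac{L(k+1)}{2}-1$; - if $d\ge U_1(n)-\frac L2$, then $W(n;d,e)=1$. 3. $n\equiv L\pmod{2L}$: - if $d<M_1(n)+\frac L2-1$, then $W(n;d,e)=2$; - for every integer $k\ge 1$, if $M_1(n)+\frac{Lk}{2}-1\le d<M_1(n)+\frac{L(k+1)}{2}-1$, then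 $W(n;d,e)=1$ when $e<M_2(n)+\frac{Lk}{2}$, and $W(n;d,e)=2$ when $e\ge M_2(n)+\frac{Lk}{2}$; - if $d\ge U_1(n)-\frac L2$, then $W(n;d,e)=1$.
   Context: $\mathbb{N}=\{0,1,2,\dots\}$. In the game $\mathrm{NIM}(A;n)$ two players alternate (Player 1 first) removing some $a\in A$ stones from a pile of $n$ stones ($a$ may not exceed the number of stones left); a player who cannot move loses. $W(n)\in\{1,2\}$ is the player with a winning strategy. In the NIM with Cash game $\mathrm{NIM}(A;n;d,e)$, Player 1 starts with $d$ dollars and Player 2 with $e$ dollars. Players alternate, Player 1 first; a move consists of removing some $a\in A$ stones and paying $a$ dollars, where $a$ may exceed neither the number of stones left nor the mover's money. A player who cannot move on his turn loses. $W(n;d,e)\in\{1,2\}$ is the player with a winning strategy. The upper class amounts $U_1(n),U_2(n)\in\mathbb{N}$ are defined recursively (depending on $A$): - If $n<\min(A)$, then $U_1(n)=U_2(n)=0$. - If $n\ge\min(A)$ and $W(n)=1$, then $U_1(n)=\min\{U_2(n-a)+a : a\in A,\ a\le n,\ W(n-a)=2\}$ and $U_2(n)=\max\{U_1(n-a): a\in A,\ a\le n\}$. - If $n\ge\min(A)$ and $W(n)=2$, then $U_2(n)=\max\{U_1(n-a): a\in A,\ a\le n\}$ and $U_1(n)=\min\{U_2(n-a)+a : a\in A,\ a\le n,\ U_1(n-a)=U_2(n)\}$. The middle class thresholds are $M_1(n)=\frac n2+1$, $M_2(n)=\frac n2$ for $n$ even, and $M_1(n)=M_2(n)=\frac{n+1}{2}$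 for $n$ odd. Player $i$ is middle class when his money is at least $M_i(n)$ and less than $U_i(n)$. *)

(* Defs.v *)
From mathcomp Require Import all_boot.
From mathcomp Require Import boolp.

Set Implicit Arguments.
Unset Strict Implicit.
Unset Printing Implicit Defensive.

Inductive player := Player1 | Player2.

(* Two-player alternating games with normal play. Moves are coded by natural
   numbers. A position does not record whose turn it is: [legal] and [next]
   are expressed from the point of view of the player about to move. *)
Record game := Game {
  position : Type;
  legal : position -> nat -> bool;
  next : position -> nat -> position
}.

Section Play.
Variable g : game.

(* A play is the sequence of the moves made so far, Player 1 having moved
   first. *)
Fixpoint legal_play (p : position g) (s : seq nat) : bool :=
  if s is a :: s' then legal p a && legal_play (next p a) s' else true.

Definition final (p : position g) (s : seq nat) : position g :=
  foldl (@next g) p s.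

Definition to_move (s : seq nat) : player :=
  if odd (size s) then Player2 else Player1.

Definition stuck (p : position g) : Prop := forall a, ~~ legal p a.

Definition complete_play (p : position g) (s : seq nat) : Prop :=
  legal_play p s /\ stuck (final p s).

Definition follows (i : player) (sigma : seq nat -> nat) (s : seq nat) : Prop :=
  forall k, k < size s -> to_move (take k s) = i ->
    nth 0 s k = sigma (take k s).

(* A strategy maps the whole history to the next move. It must move legally
   whenever a move exists; the player to move at the end of a complete play
   loses. The definition is only meaningful for games without infinite plays,
   such as the two games below when [0 \notin A]. *)
Definition winning_strategy (p : position g) (i : player)
    (sigma : seq nat -> nat) : Prop :=
  (forall s, legal_play p s -> follows i sigma s -> to_move s = i ->
     ~ stuck (final p s) -> legal (final p s) (sigma s)) /\
  (forall s, complete_play p s -> follows i sigma s -> to_move s <> i).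

Definition wins (p : position g) (i : player) : Prop :=
  exists sigma, winning_strategy p i sigma.

End Play.

Definition nim (A : seq nat) : game :=
  @Game nat (fun n a => (a \in A) && (a <= n)) (fun n a => n - a).

(* Position (n, x, y): n stones, x dollars for the player about to move and
   y dollars for the other one; the amounts are swapped after each move. *)
Definition cash_nim (A : seq nat) : game :=
  @Game (nat * nat * nat)
    (fun p a => let: (n, x, _) := p in [&& a \in A, a <= n & a <= x])
    (fun p a => let: (n, x, y) := p in (n - a, y, x - a)).

(* [W A n i] is W(n) = i and [Wcash A n d e i] is W(n; d, e) = i. *)
Definition W (A : seq nat) (n : nat) (i : player) : Prop :=
  wins (n : position (nim A)) i.

Definition Wcash (A : seq nat) (n d e : nat) (i : player) : Prop :=
  wins ((n, d, e) : position (cash_nim A)) i.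

(* Minimum of a nonempty sequence (0 on the empty one). *)
Definition seqmin (s : seq nat) : nat := foldr minn (head 0 s) (behead s).

(* Right-hand side of the recursion for (U_1(n), U_2(n)). *)
Definition upper_step (A : seq nat) (u : nat -> nat * nat) (n : nat) :
    nat * nat :=
  if n < seqmin A then (0, 0)
  else
    let u2n := \max_(a <- A | a <= n) (u (n - a)).1 in
    let u1n :=
      if `[< W A n Player1 >] then
        seqmin [seq (u (n - a)).2 + a
               | a <- A & (a <= n) && `[< W A (n - a) Player2 >]]
      else
        seqmin [seq (u (n - a)).2 + a
               | a <- A & (a <= n) && ((u (n - a)).1 == u2n)]
    in (u1n, u2n).

Fixpoint upper_rec (A : seq nat) (fuel n : nat) : nat * nat :=
  if fuel is fuel'.+1 then upper_step A (upper_rec A fuel') n else (0, 0).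

Definition upper (A : seq nat) (n : nat) : nat * nat := upper_rec A n.+1 n.

Definition U1 (A : seq nat) (n : nat) : nat := (upper A n).1.
Definition U2 (A : seq nat) (n : nat) : nat := (upper A n).2.

Lemma eq_upper_step (A : seq nat) (u v : nat -> nat * nat) (n : nat) :
  {in A, forall a, a <= n -> u (n - a) = v (n - a)} ->
  upper_step A u n = upper_step A v n.
Proof.
move=> uv; rewrite /upper_step; case: ifP => // _.
have -> : \max_(a <- A | a <= n) (u (n - a)).1
        = \max_(a <- A | a <= n) (v (n - a)).1.
  rewrite big_seq_cond [RHS]big_seq_cond.
  by apply: eq_bigr => a /andP[aA an]; rewrite uv.
have eqm (P Q : pred nat) :
    {in A, forall a, a <= n -> P a = Q a} ->
    [seq (u (n - a)).2 + a | a <- A & (a <= n) && P a]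
    = [seq (v (n - a)).2 + a | a <- A & (a <= n) && Q a].
  move=> PQ; rewrite (@eq_in_filter _ _ (fun a => (a <= n) && Q a)).
    by apply/eq_in_map => a; rewrite mem_filter => /andP[/andP[an _] aA];
       rewrite uv.
  by move=> a aA; case: (boolP (a <= n)) => //= an; rewrite PQ.
congr (_, _); case: ifP => _; congr seqmin; apply: eqm => // a aA an.
by rewrite uv.
Qed.

(* The fuel is irrelevant: [upper] satisfies the defining recursion. *)
Lemma upperE (A : seq nat) (n : nat) :
  0 \notin A -> upper A n = upper_step A (upper A) n.
Proof.
move=> A0.
have fuelE k : forall m m', k < m -> k < m' ->
    upper_rec A m k = upper_rec A m' k.
  elim/ltn_ind: k => k IHk [//|m] [//|m'] km km' /=.
  apply: eq_upper_step => a aA ak.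
  have a0 : 0 < a by rewrite lt0n; apply: contraNneq A0 => <-.
  have ka : k - a < k by rewrite ltn_subrL a0 (leq_trans a0 ak).
  by apply: IHk => //; apply: leq_trans ka _.
rewrite {1}/upper /=; apply: eq_upper_step => a aA an.
have a0 : 0 < a by rewrite lt0n; apply: contraNneq A0 => <-.
by apply: fuelE => //; rewrite ltn_subrL a0 (leq_trans a0 an).
Qed.

Definition M1 (n : nat) : nat := if odd n then n.+1./2 else n./2.+1.
Definition M2 (n : nat) : nat := if odd n then n.+1./2 else n./2.

(* Main.v *)
Require Import Defs.
From mathcomp Require Import all_boot.
From mathcomp Require Import boolp zify.

(* Write L = 2h, k = floor(n/2), N = floor(k/h) = floor(n/L) and Q = ceil(N/2).
   The upper class amounts have the closed form U_1(n) = ceil(n/2) + hQ and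
   U_2(n) = U_1(n-1). With money x for the mover and y for the opponent, the
   winner with cash depends only on comparisons between Q and the quotients by
   h of the distances of x and y to about n/2: removing one stone leaves these
   quotients unchanged, while removing about L stones changes each of them, as
   well as N, by about one. This gives a predicate [cash_win], defined on all
   positions (rich and poor ones included), that satisfies the backward
   induction of the game. *)

Set Implicit Arguments.
Unset Strict Implicit.
Unset Printing Implicit Defensive.

(** * Backward induction and uniqueness of the winner in abstract games *)

Section Games.
Variable g : game.
Implicit Types (p : position g) (s : seq nat) (i : player).

Definition opponent i := if i is Player1 then Player2 else Player1.

Lemma to_move_rcons s a : to_move (rcons s a) = opponent (to_move s).
Proof. by rewrite /to_move size_rcons /=; case: odd. Qed.

Lemma legal_play_rcons p s a :
  legal_play p (rcons s a) = legal_play p s && legal (final p s) a.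
Proof. by elim: s p => [|b s IHs] p /=; rewrite ?andbT // IHs andbA. Qed.

Lemma final_rcons p s a : final p (rcons s a) = Defs.next (final p s) a.
Proof. by rewrite /final foldl_rcons. Qed.

Lemma follows_rcons i sigma s a :
  follows i sigma (rcons s a) <->
  follows i sigma s /\ (to_move s = i -> a = sigma s).
Proof.
split=> [F | [F Fa] k].
  split=> [k ks ki | si].
    have := F k; rewrite size_rcons ltnS (ltnW ks) nth_rcons ks.
    by rewrite -cats1 takel_cat ?(ltnW ks) //; apply.
  have := F (size s); rewrite size_rcons ltnSn nth_rcons ltnn eqxx.
  by rewrite -cats1 take_size_cat //; apply.
rewrite size_rcons ltnS nth_rcons -cats1 leq_eqVlt => /predU1P[-> | ks].
  by rewrite ltnn eqxx take_size_cat.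
by rewrite ks takel_cat ?(ltnW ks) //; apply: F.
Qed.

(** The label [w] marks positions won by the player about to move. The strategy looks only at the
    current position and moves to an unmarked one; any legal reply leads back to a marked one, so
    the favoured player always faces positions that have a move. *)
Lemma backward_wins (w : position g -> bool) p :
  (forall q, w q -> exists a, legal q a && ~~ w (Defs.next q a)) ->
  (forall q a, ~~ w q -> legal q a -> w (Defs.next q a)) ->
  wins p (if w p then Player1 else Player2).
Proof.
move=> winning losing; set i := if w p then _ else _.
have /choice[best bestP] : forall q, exists a,
    w q -> legal q a && ~~ w (Defs.next q a).
  move=> q; case: (boolP (w q)) => [/winning[a qa] | _]; last by exists 0.
  by exists a.
pose sigma s := best (final p s).
(* Invariant: the current position is marked exactly on the turns of the favoured player [i]. *)
have inv s : legal_play p s -> follows i sigma s ->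
    (w (final p s) <-> to_move s = i).
  elim/last_ind: s => [|s a IHs]; first by rewrite /i /=; case: (w p).
  rewrite legal_play_rcons follows_rcons final_rcons to_move_rcons.
  move=> /andP[ls sa] [/(IHs ls) IH Fa].
  case: (boolP (w (final p s))) => [ws | nws].
    have si : to_move s = i by apply/IH.
    rewrite (Fa si) si; have /andP[_ /negbTE->] := bestP _ ws.
    by split=> //; case: (i).
  have si : to_move s <> i by move/IH; rewrite (negbTE nws).
  by rewrite losing //; split=> // _; case: (to_move s) (i) si => -[].
exists sigma; split=> [s ls fs si _ | s [ls st] fs si].
  by have /bestP/andP[] : w (final p s) by apply/inv.
have /winning[a /andP[la _]] : w (final p s) by apply/inv.
by have := st a; rewrite la.
Qed.

(** Let two winning strategies play each other: the decreasing [size] forces a stuck position, and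
    there each strategy forbids that its own player is to move. *)
Lemma wins_unique (size : position g -> nat) p :
  (forall q a, legal q a -> size (Defs.next q a) < size q) ->
  wins p Player1 -> ~ wins p Player2.
Proof.
move=> decr [sigma [sigma_legal sigma_wins]] [tau [tau_legal tau_wins]].
suff noplay m s : size (final p s) < m -> legal_play p s ->
    follows Player1 sigma s -> follows Player2 tau s -> False.
  by apply: (@noplay (size p).+1 [::]).
elim: m s => // m IHm s sm ls fs ft.
have [st | nst] := pselect (stuck (final p s)).
  have := sigma_wins s (conj ls st) fs; have := tau_wins s (conj ls st) ft.
  by case: to_move.
case si: (to_move s).
  have la := sigma_legal s ls fs si nst.
  apply: (IHm (rcons s (sigma s))); last 1 first.
  - by rewrite follows_rcons si.
  - by rewrite final_rcons (leq_trans (decr _ _ la)).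
  - by rewrite legal_play_rcons ls.
  - by rewrite follows_rcons.
have la := tau_legal s ls ft si nst.
apply: (IHm (rcons s (tau s))).
- by rewrite final_rcons (leq_trans (decr _ _ la)).
- by rewrite legal_play_rcons ls.
- by rewrite follows_rcons si.
- by rewrite follows_rcons.
Qed.

End Games.

(** * Quotients by [h], the half of L *)

Section Thresholds.
Variable h : nat.
Hypothesis h_gt1 : 1 < h.
Local Notation A := [:: 1; 2 * h; (2 * h).+1].

Let h_gt0 : 0 < h := ltnW h_gt1.

(* Named so that [lia] treats these quotients as atoms: a division by the
   variable [h] would be nonlinear. *)
Definition quo t := t %/ h.

Lemma quo_small t : t < h -> quo t = 0.
Proof. exact: divn_small. Qed.

Lemma quo_trunc s t : s <= t -> quo (s - t) = 0.
Proof. by rewrite -subn_eq0 => /eqP->; apply: quo_small. Qed.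

Lemma quo_mono s t : s <= t -> quo s <= quo t.
Proof. exact: leq_div2r. Qed.

Lemma quo_sub t : h <= t -> quo t = (quo (t - h)).+1.
Proof.
by move=> ht; rewrite /quo -{1}(subnK ht) divnDr ?divnn ?h_gt0 ?addn1.
Qed.

Lemma quo_pred_bounds t : quo t.-1 <= quo t <= (quo t.-1).+1.
Proof.
rewrite quo_mono ?leq_pred //=.
have -> : (quo t.-1).+1 = quo (t.-1 + h).
  by rewrite [RHS]quo_sub ?leq_addl // addnK.
by apply: quo_mono; lia.
Qed.

Lemma quo_eq t j : h * j <= t < h * j.+1 -> quo t = j.
Proof.
rewrite ![h * _]mulnC => /andP[jt tj]; apply/eqP; rewrite eqn_leq.
by rewrite -ltnS ltn_divLR // leq_divRL // jt tj.
Qed.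

(** * The winner of NIM without cash *)

Definition nim_win n := odd n || odd (quo n./2).

Lemma nim_win_sub1 n :
  0 < n -> nim_win (n - 1) = ~~ odd n || odd (quo n./2).
Proof.
move=> n0; rewrite /nim_win; case on: (odd n) => /=.
  by have [-> ->] : odd (n - 1) = false /\ (n - 1)./2 = n./2 by lia.
by have -> : odd (n - 1) by lia.
Qed.

Lemma nim_win_subL n :
  2 * h <= n -> nim_win (n - 2 * h) = odd n || ~~ odd (quo n./2).
Proof.
move=> hn; rewrite (@quo_sub n./2) /= ?negbK /nim_win; last by lia.
by have [-> ->] : odd (n - 2 * h) = odd n /\ (n - 2 * h)./2 = n./2 - h by lia.
Qed.

Lemma nim_win_subL1 n :
  2 * h < n -> nim_win (n - (2 * h).+1) = ~~ odd n || ~~ odd (quo n./2).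
Proof.
move=> hn; rewrite subnS -subn1 nim_win_sub1 ?subn_gt0 // (@quo_sub n./2).
  have [-> ->] : odd (n - 2 * h) = odd n /\ (n - 2 * h)./2 = n./2 - h by lia.
  by rewrite /= negbK.
by lia.
Qed.

(** The lost piles are those congruent to 0, 2, ..., L-2 modulo 2L, as [quo n./2] is floor(n/L).
    From an odd quotient, removing L or L+1 stones reaches an even pile with an even quotient; from
    an odd pile with an even quotient, removing one stone does. *)
Lemma nim_wins n : W A n (if nim_win n then Player1 else Player2).
Proof.
apply: (@backward_wins (nim A) nim_win n) => {n} [n wn | n a]; last first.
  rewrite {1}/nim_win negb_or => /andP[/negbTE on /negbTE oN].
  rewrite /= !inE => /andP[/or3P[]/eqP-> an].
  - by rewrite nim_win_sub1 ?on.
  - by rewrite nim_win_subL ?oN ?orbT.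
  - by rewrite nim_win_subL1 ?on.
move: wn; rewrite {1}/nim_win.
case: (boolP (odd (quo n./2))) => [oN _ | /negbTE oN].
  have hn : h <= n./2.
    by rewrite leqNgt; apply: contraTN oN => /quo_small->.
  case on: (odd n).
    exists (2 * h).+1; rewrite /= ?inE ?eqxx ?orbT nim_win_subL1 ?oN ?on; lia.
  by exists (2 * h); rewrite /= ?inE ?eqxx ?orbT nim_win_subL ?oN ?on; lia.
rewrite orbF => on; exists 1; rewrite /= ?inE ?eqxx nim_win_sub1 ?oN ?on; lia.
Qed.

Lemma nim_winP n : (`[< W A n Player1 >] = nim_win n) /\
  (`[< W A n Player2 >] = ~~ nim_win n).
Proof.
have notboth : W A n Player1 -> ~ W A n Player2.
  apply: (@wins_unique (nim A) (fun q : nat => q)) => q a /=.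
  by rewrite !inE => /andP[aA aq]; lia.
have := nim_wins n; case: (nim_win n) => /= Wn; split.
- exact/asboolP.
- by apply/asboolP; apply: notboth.
- by apply/asboolP => W1; case: (notboth W1 Wn).
- exact/asboolP.
Qed.

(** * The closed form of the upper class amounts *)

Definition upper1 n := uphalf n + h * uphalf (quo n./2).

Lemma upper1_mono n n' : n <= n' -> upper1 n <= upper1 n'.
Proof.
move=> nn'; apply: leq_add; first exact: uphalf_leq.
by rewrite leq_mul2l uphalf_leq ?orbT // quo_mono // half_leq.
Qed.

(** Two extra stones raise [uphalf n], whereas a single one may leave [upper1] unchanged. This is
    what keeps the moves L and L+1 from attaining U_2(n). *)
Lemma upper1_strict n n' : n.+1 < n' -> upper1 n < upper1 n'.
Proof.
move=> nn'; rewrite -addSn; apply: leq_add; first by lia.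
by rewrite leq_mul2l uphalf_leq ?orbT // quo_mono // half_leq //; lia.
Qed.

Lemma upper1_double k : upper1 k.*2 = k + h * uphalf (quo k).
Proof. by rewrite /upper1 doubleK uphalf_double. Qed.

Lemma upper1_doubleS k : upper1 k.*2.+1 = k.+1 + h * uphalf (quo k).
Proof. by rewrite /upper1 /= uphalf_double doubleK. Qed.

(** From [k.-1] to [k] the quotient grows by at most one; if it grows to an even number, from 2m-1
    to 2m, its rounded-up half is m both times. *)
Lemma uphalf_quo_pred k :
  ~~ odd (quo k) -> uphalf (quo k.-1) = uphalf (quo k).
Proof.
by have := quo_pred_bounds k; move: (quo _) (quo _) => q q'; lia.
Qed.

Lemma upper1_double_pred k :
  ~~ odd (quo k) -> upper1 k.*2.-1 = k + h * uphalf (quo k).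
Proof.
move/uphalf_quo_pred; case: k => [|k] <-;
  first by rewrite /upper1 quo_small // muln0.
by rewrite doubleS -upper1_doubleS.
Qed.

(** In each case the minimum has a single candidate: if NIM is won, only one move reaches a lost
    pile; if it is lost, only removing one stone attains the maximum. *)
Lemma upper_closed n : upper A n = (upper1 n, upper1 n.-1).
Proof.
have A0 : 0 \notin A by rewrite !inE; lia.
elim/ltn_ind: n => n IHn.
rewrite upperE // /upper_step.
have -> : seqmin A = 1 by rewrite /seqmin /=; lia.
rewrite ltnS leqn0; case: posnP => [-> | n0].
  by rewrite /upper1 /= quo_small // muln0.
have U a : 0 < a -> upper A (n - a) = (upper1 (n - a), upper1 (n - a).-1).
  by move=> a0; rewrite IHn //; lia.
(* By monotonicity, removing one stone gives the maximum. *)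
have -> : \max_(a <- A | a <= n) (upper A (n - a)).1 = upper1 n.-1.
  rewrite !big_cons big_nil !U ?maxn0 ?subn1 //; try lia.
  have m1 : upper1 (n - 2 * h) <= upper1 n.-1 by apply: upper1_mono; lia.
  have m2 : upper1 (n - (2 * h).+1) <= upper1 n.-1 by apply: upper1_mono; lia.
  by rewrite /fst n0; case: ifP => _; case: ifP => _; lia.
rewrite (nim_winP n).1; congr (_, _).
have [k [b nE]] : exists k (b : bool), n = b + k.*2.
  by exists n./2, (odd n); rewrite odd_double_half.
have half_n : n./2 = k by lia.
have odd_n : odd n = b by lia.
have [move1 moveL moveL1] :
  [/\ (0 < n) && `[< W A (n - 1) Player2 >] = b && ~~ odd (quo k),
     (2 * h <= n) && `[< W A (n - 2 * h) Player2 >]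
       = [&& 2 * h <= n, ~~ b & odd (quo k)]
   & (2 * h < n) && `[< W A (n - (2 * h).+1) Player2 >]
       = [&& 2 * h < n, b & odd (quo k)]].
  rewrite -half_n -odd_n !(nim_winP _).2 nim_win_sub1 // n0 negb_or negbK; split=> //.
    by case: leqP => // /nim_win_subL->; rewrite negb_or negbK.
  by case: leqP => // /nim_win_subL1->; rewrite negb_or !negbK.
rewrite {2}/upper1 /nim_win half_n odd_n.
have ukE : uphalf n = b + k by lia.
rewrite ukE.
case: (boolP (odd (quo k))) move1 moveL moveL1 => oN.
  have hk : h <= k by rewrite leqNgt; apply: contraTN oN => /quo_small->.
  have NE := quo_sub hk.
  have oN' : ~~ odd (quo (k - h)) by move: oN; rewrite NE.
  (* The winning move pays [2 * h] or one more while the half pile loses [h]; the surplus [h] is the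
     step from ceil((N-1)/2) to ceil(N/2) for odd N. *)
  have -> : h * uphalf (quo k) = h * uphalf (quo (k - h)) + h.
    by rewrite NE /= mulnS addnC uphalf_half (negbTE oN').
  have val a : 0 < a -> (n - a).-1 = (k - h).*2.-1 ->
      (upper A (n - a)).2 = k - h + h * uphalf (quo (k - h)).
    by move=> a0 aE; rewrite U //= aE upper1_double_pred.
  rewrite andbF orbT !andbT; move: (h * _) val => P val.
  move=> move1 moveL moveL1; rewrite /= move1 moveL moveL1.
  case: b nE {odd_n ukE move1 moveL moveL1} => nE; rewrite ?andbF ifT /=; try lia.
    by rewrite /seqmin /= val //; lia.
  by rewrite /seqmin /= val //; lia.
rewrite ?andbF ?andbT ?orbF => move1 moveL moveL1.
case: b nE odd_n move1 moveL moveL1 ukE => nE odd_n move1 moveL moveL1 ukE.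
  rewrite /= move1 moveL moveL1 /seqmin /= U //= (_ : (n - 1).-1 = k.*2.-1).
    by rewrite upper1_double_pred //; move: (h * _) => P; lia.
  by lia.
have h2_gt0 : 0 < 2 * h by lia.
rewrite /= !U // {1}subn1 eqxx n0 /=.
have notL : (2 * h <= n) && (upper1 (n - 2 * h) == upper1 n.-1) = false.
  by case: leqP => // hn; apply/negbTE; rewrite neq_ltn upper1_strict //; lia.
have notL1 : (2 * h < n) && (upper1 (n - (2 * h).+1) == upper1 n.-1) = false.
  by case: leqP => // hn; apply/negbTE; rewrite neq_ltn upper1_strict //; lia.
rewrite notL notL1 /seqmin /= U //= (_ : (n - 1).-1 = k.-1.*2); last by lia.
by rewrite upper1_double uphalf_quo_pred //; move: (h * _) => P; lia.
Qed.

(** * The winner of NIM with Cash at every position *)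

(* For odd n, when y < k the truncated difference y - k is 0 and the last
   inequality holds, so that case needs no separate treatment. *)
Definition cash_win (p : nat * nat * nat) : bool :=
  let: (n, x, y) := p in
  let k := n./2 in
  let N := quo k in
  if odd n then
    if x <= k then y < x
    else (uphalf N <= quo (x - k.+1)) || (quo (y - k) <= quo (x - k.+1))
  else
    if x < k then y < x
    else (y < k) ||
      if odd N then (uphalf N <= quo (x - k)) || (quo (y - k) < quo (x - k))
      else (quo (y - k) < uphalf N) && (quo (y - k) < quo (x - k)).

Lemma cash_win_odd k x y : cash_win (k.*2.+1, x, y) =
  if x <= k then y < x
  else (uphalf (quo k) <= quo (x - k.+1)) || (quo (y - k) <= quo (x - k.+1)).
Proof. by rewrite /cash_win /= odd_double uphalf_double. Qed.

Lemma cash_win_even k x y : cash_win (k.*2, x, y) =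
  if x < k then y < x
  else (y < k) ||
    if odd (quo k)
    then (uphalf (quo k) <= quo (x - k)) || (quo (y - k) < quo (x - k))
    else (quo (y - k) < uphalf (quo k)) && (quo (y - k) < quo (x - k)).
Proof. by rewrite /cash_win /= odd_double doubleK. Qed.

Arguments cash_win : simpl never.

(** Removing one stone keeps both distances. Removing L or L+1 stones lowers the half pile by [h] at
    a cost of about [2 * h]: the mover's distance falls by about [h] and the opponent's grows by
    about [h], which helps the opponent. *)
Lemma cash_win_odd_losing k x y a :
  ~~ cash_win (k.*2.+1, x, y) -> @legal (cash_nim A) (k.*2.+1, x, y) a ->
  cash_win (k.*2.+1 - a, y, x - a).
Proof.
have q0 := quo_small h_gt0.
have yk0 := @quo_trunc y k.
rewrite cash_win_odd /= !inE => lose /andP[/or3P[]/eqP-> /andP[an ax]].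
- have -> : k.*2.+1 - 1 = k.*2 by lia.
  rewrite cash_win_even.
  have -> : x - 1 - k = x - k.+1 by lia.
  move: lose; case: (leqP x k) => xk; first by case: (ltnP y k); lia.
  case: (ltnP y k) => yk; first by have := yk0 (ltnW yk); lia.
  by case: ifP; lia.
- have -> : k.*2.+1 - 2 * h = (k - h).*2.+1 by lia.
  rewrite cash_win_odd; case: (leqP y (k - h)) => yk;
    first by move: lose; case: (leqP x k); lia.
  have Y : quo (y - k) <= quo (y - (k - h).+1) by apply: quo_mono; lia.
  have N : quo k = (quo (k - h)).+1 by apply: quo_sub; lia.
  move: lose; case: (leqP x k) => xk lose.
    have -> : x - 2 * h - (k - h) = 0 by lia.
    by rewrite q0 leq0n orbT.
  have X : quo (x - 2 * h - (k - h)) <= quo (x - k.+1) by apply: quo_mono; lia.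
  by lia.
- have -> : k.*2.+1 - (2 * h).+1 = (k - h).*2 by lia.
  rewrite cash_win_even; case: (ltnP y (k - h)) => yk;
    first by move: lose; case: (leqP x k); lia.
  have N : quo k = (quo (k - h)).+1 by apply: quo_sub; lia.
  case: (ltnP (x - (2 * h).+1) (k - h)) => //= xk.
  move: lose; rewrite ifF => [lose|]; last by lia.
  have X : quo (x - k.+1) = (quo (x - (2 * h).+1 - (k - h))).+1.
    by rewrite quo_sub; [congr (quo _).+1|]; lia.
  (* The losing inequality makes [quo (y - k)] positive, so the subtraction is not truncated. *)
  have yk' : k <= y.
    by rewrite leqNgt; apply/negP => yk'; have := yk0 (ltnW yk'); lia.
  have Y : quo (y - (k - h)) = (quo (y - k)).+1.
    by rewrite quo_sub; [congr (quo _).+1|]; lia.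
  by case: ifP; lia.
Qed.

Lemma cash_win_even_losing k x y a :
  ~~ cash_win (k.*2, x, y) -> @legal (cash_nim A) (k.*2, x, y) a ->
  cash_win (k.*2 - a, y, x - a).
Proof.
have q0 := quo_small h_gt0.
have yk0 := @quo_trunc y k.
rewrite cash_win_even /= !inE => lose /andP[/or3P[]/eqP-> /andP[an ax]].
- have -> : k.*2 - 1 = k.-1.*2.+1 by lia.
  rewrite cash_win_odd; case: (leqP y k.-1) => yk;
    first by move: lose; case: (ltnP x k); lia.
  have -> : y - k.-1.+1 = y - k by lia.
  (* The quotient drops when [h] divides [k]; this can only lower the threshold that the next mover
     has to reach. *)
  have N := quo_pred_bounds k.
  move: lose; case: (ltnP x k) => xk lose.
    have -> : x - 1 - k.-1 = 0 by lia.
    by rewrite q0 leq0n orbT.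
  have -> : x - 1 - k.-1 = x - k by lia.
  by move: lose; case: ifP; lia.
- have -> : k.*2 - 2 * h = (k - h).*2 by lia.
  rewrite cash_win_even; case: (ltnP y (k - h)) => yk;
    first by move: lose; case: (ltnP x k); lia.
  case: (ltnP (x - 2 * h) (k - h)) => //= xk.
  have N : quo k = (quo (k - h)).+1 by apply: quo_sub; lia.
  move: lose; rewrite ifF => [lose|]; last by lia.
  have X : quo (x - k) = (quo (x - 2 * h - (k - h))).+1.
    by rewrite quo_sub; [congr (quo _).+1|]; lia.
  have Y : quo (y - (k - h)) = (quo (y - k)).+1.
    by rewrite quo_sub; [congr (quo _).+1|]; lia.
  by move: lose; case: ifP; case: ifP; lia.
- have -> : k.*2 - (2 * h).+1 = (k - h.+1).*2.+1 by lia.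
  rewrite cash_win_odd; case: (leqP y (k - h.+1)) => yk;
    first by move: lose; case: (ltnP x k); lia.
  have N : quo (k - h.+1) <= quo k by apply: quo_mono; lia.
  move: lose; case: (ltnP x k) => xk lose.
    have -> : x - (2 * h).+1 - (k - h.+1) = 0 by lia.
    by rewrite q0 leq0n orbT.
  have X : quo (x - (2 * h).+1 - (k - h.+1)) <= quo (x - k) by apply: quo_mono; lia.
  have Y : quo (y - (k - h.+1).+1) = (quo (y - k)).+1.
    by rewrite quo_sub; [congr (quo _).+1|]; lia.
  by move: lose; case: ifP; lia.
Qed.

(** For odd [quo k] and a mover whose quotient reaches the threshold, removing L+1 stones lowers
    both the quotient and the threshold by one and makes [quo k] even, where an opponent at the
    threshold beats the player to move. Otherwise one stone is removed. *)
Lemma cash_win_odd_winning k x y : cash_win (k.*2.+1, x, y) ->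
  exists a, @legal (cash_nim A) (k.*2.+1, x, y) a &&
    ~~ cash_win (k.*2.+1 - a, y, x - a).
Proof.
have q0 := quo_small h_gt0.
have yk0 := @quo_trunc y k.
rewrite cash_win_odd => win.
have [big | small] := boolP
  [&& odd (quo k), k < x & uphalf (quo k) <= quo (x - k.+1)].
  have hk : h <= k by rewrite leqNgt; apply/negP => /quo_small K; lia.
  have hx : h <= x - k.+1 by rewrite leqNgt; apply/negP => /quo_small X; lia.
  exists (2 * h).+1; apply/andP; split; first by rewrite /= !inE; lia.
  have -> : k.*2.+1 - (2 * h).+1 = (k - h).*2 by lia.
  rewrite cash_win_even; case: (ltnP y (k - h)) => yk; first by lia.
  have N := quo_sub hk; have := quo_sub hx.
  have -> : x - k.+1 - h = x - (2 * h).+1 - (k - h) by lia.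
  by case: ifP; lia.
exists 1; apply/andP; split; first by
  rewrite /=; move: win; case: (leqP x k); lia.
have -> : k.*2.+1 - 1 = k.*2 by lia.
rewrite cash_win_even.
have -> : x - 1 - k = x - k.+1 by lia.
by move: win; case: (leqP x k) => xk; case: (ltnP y k) => yk;
  try case: ifP; lia.
Qed.

Lemma cash_win_even_winning k x y : cash_win (k.*2, x, y) ->
  exists a, @legal (cash_nim A) (k.*2, x, y) a &&
    ~~ cash_win (k.*2 - a, y, x - a).
Proof.
have q0 := quo_small h_gt0.
have yk0 := @quo_trunc y k.
rewrite cash_win_even => win.
have [big | small] := boolP
  [&& odd (quo k), k <= x & uphalf (quo k) <= quo (x - k)].
  have hk : h <= k by rewrite leqNgt; apply/negP => /quo_small K; lia.
  have hx : h <= x - k by rewrite leqNgt; apply/negP => /quo_small X; lia.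
  exists (2 * h); apply/andP; split; first by rewrite /= !inE; lia.
  have -> : k.*2 - 2 * h = (k - h).*2 by lia.
  rewrite cash_win_even; case: (ltnP y (k - h)) => yk; first by lia.
  have N := quo_sub hk; have := quo_sub hx.
  have -> : x - k - h = x - 2 * h - (k - h) by lia.
  by case: ifP; lia.
(* On the empty pile every clause of [cash_win] fails. *)
have k_gt0 : 0 < k.
  by rewrite lt0n; apply/eqP => k0; move: win; rewrite k0 !q0 //=; lia.
exists 1; apply/andP; split; first by
  rewrite /=; move: win; case: (ltnP x k); lia.
have -> : k.*2 - 1 = k.-1.*2.+1 by lia.
have N := quo_pred_bounds k.
rewrite cash_win_odd.
have -> : y - k.-1.+1 = y - k by lia.
have -> : x - 1 - k.-1 = x - k by lia.
by move: win; case: (ltnP x k) => xk; case: (leqP y k.-1) => yk;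
  try case: ifP; lia.
Qed.

Lemma cash_winP n x y :
  Wcash A n x y (if cash_win (n, x, y) then Player1 else Player2).
Proof.
apply: (@backward_wins (cash_nim A) cash_win (n, x, y)) => -[[m u] v].
  rewrite -(odd_double_half m); case: odd.
    exact: cash_win_odd_winning.
  exact: cash_win_even_winning.
rewrite -(odd_double_half m) => a; case: odd.
  exact: cash_win_odd_losing.
exact: cash_win_even_losing.
Qed.

(** * Restriction to the middle class *)

Lemma cash_win_odd_middle k j x y : j < uphalf (quo k) ->
  h * j <= x - k.+1 < h * j.+1 -> k < x -> k <= y ->
  cash_win (k.*2.+1, x, y) = (y < k + h * j.+1).
Proof.
move=> jQ /quo_eq xj kx ky; rewrite cash_win_odd xj leqNgt kx /= leqNgt jQ /=.
by rewrite -ltnS ltn_divLR // mulnC ltn_subLR.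
Qed.

(** With the mover's quotient [j] below the threshold, the clauses for odd and even [quo k] both
    reduce to [quo (y - k) < j]. *)
Lemma cash_win_even_middle k j x y : j < uphalf (quo k) ->
  h * j <= x - k < h * j.+1 -> k <= x -> k <= y ->
  cash_win (k.*2, x, y) = (y < k + h * j).
Proof.
move=> jQ /quo_eq xj kx ky; rewrite cash_win_even xj ltnNge kx /= ltnNge ky /=.
have -> : (y < k + h * j) = (quo (y - k) < j).
  by rewrite ltn_divLR // mulnC ltn_subLR.
by case: ifP => _; lia.
Qed.

(** Residue L modulo 2L means an odd multiple of L. Among even piles these are exactly the ones
    where U_2 differs from U_1. *)
Lemma modn_4h_eq_2h k :
  (k.*2 %% (2 * (2 * h)) == 2 * h) = odd (quo k) && (k == h * quo k).
Proof.
rewrite -mul2n -muln_modr eqn_pmul2l //.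
set t := k %% h; have t_lt : t < h by rewrite ltn_mod.
have kE : k = quo k * h + t by apply: divn_eq.
have -> : (k == h * quo k) = (t == 0).
  by rewrite {1}kE [quo k * h]mulnC -{2}[h * _]addn0 eqn_add2l.
clearbody t.
(* Twice the half of [quo k] contributes a multiple of [2 * h], so only its parity survives in the
   remainder. *)
rewrite [X in X %% _](_ : k = (quo k)./2 * (2 * h) + (odd (quo k) * h + t)).
  by rewrite modnMDl; case: odd; rewrite ?mul1n ?mul0n modn_small; lia.
by rewrite {1}kE -{1}(odd_double_half (quo k)) -muln2; lia.
Qed.

(** Here [k.-1] has the even quotient N-1, so the rounded-up half drops by one and U_2 falls [h]
    short of U_1. *)
Lemma upper1_double_pred_multiple k : odd (quo k) -> k = h * quo k ->
  upper1 k.*2.-1 + h = k + h * uphalf (quo k).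
Proof.
case: k => [|k]; first by rewrite quo_small.
rewrite doubleS upper1_doubleS; case: (quo k.+1) => // N /= oN kE.
rewrite (@quo_eq k N); first by rewrite uphalf_half (negbTE oN) mulnS; lia.
by move: kE; rewrite mulnS; move: (h * N) => P; lia.
Qed.

Lemma upper1_double_pred_nonmultiple k :
  ~~ (odd (quo k) && (k == h * quo k)) ->
  upper1 k.*2.-1 = k + h * uphalf (quo k).
Proof.
case: (boolP (odd (quo k))) => [oN /= kE | oN _]; last exact: upper1_double_pred.
have kN : h * quo k <= k by rewrite mulnC leq_divM.
have kN' : k < h * (quo k).+1 by rewrite mulnC ltn_ceil.
case: k kE kN kN' oN => [|k] kE kN kN' oN; first by rewrite quo_small in oN.
rewrite doubleS upper1_doubleS (@quo_eq k (quo k.+1)) //.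
by move: kE; rewrite neq_ltn => /orP[]; move: (h * _) (h * _) kN kN' => P P'; lia.
Qed.

(** The intervals for [d] are the level sets of the mover's quotient, and [d < U1 A n] keeps that
    quotient below the threshold. *)
Lemma cash_win_middle_class n d e :
  let r := n %% (2 * (2 * h)) in
  M1 n <= d < U1 A n ->
  M2 n <= e < U2 A n ->
  [/\ ~~ odd r -> r != 2 * h ->
      [/\ d < M1 n + h - 1 -> ~~ cash_win (n, d, e),
          forall k : nat, 1 <= k ->
            M1 n + h * k - 1 <= d < M1 n + h * k.+1 - 1 ->
            cash_win (n, d, e) = (e < M2 n + h * k)
        & U1 A n - h <= d -> cash_win (n, d, e) = (e < U2 A n - h)],
      odd r ->
      (forall k : nat,
         M1 n + h * k <= d < M1 n + h * k.+1 ->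
         cash_win (n, d, e) = (e < M2 n + h * k.+1 - 1)) /\
      (U1 A n - h <= d -> cash_win (n, d, e))
    & r = 2 * h ->
      [/\ d < M1 n + h - 1 -> ~~ cash_win (n, d, e),
          forall k : nat, 1 <= k ->
            M1 n + h * k - 1 <= d < M1 n + h * k.+1 - 1 ->
            cash_win (n, d, e) = (e < M2 n + h * k)
        & U1 A n - h <= d -> cash_win (n, d, e)]].
Proof.
move=> r; rewrite /U1 /U2 !upper_closed /=.
have odd_r : odd r = odd n by rewrite odd_mod // oddM.
have r2h : r = 2 * h -> ~~ odd n by rewrite -odd_r => ->; rewrite oddM.
rewrite odd_r; move: @r {odd_r} r2h => /= r2h.
rewrite /M1 /M2; case: (boolP (odd n)) => on.
  have [k nE] : exists k, n = k.*2.+1 by exists n./2; lia.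
  rewrite nE upper1_doubleS [_.-1]/= upper1_double.
  have -> : (k.*2.+1).+1./2 = k.+1 by lia.
  move=> dP eP.
  have below j : h * j < h * uphalf (quo k) -> j < uphalf (quo k).
    by rewrite ltn_pmul2l.
  move: (@cash_win_odd_middle k) below dP eP.
  move: (uphalf _) => Q mid below dP eP.
  split=> // [_ | rh]; last by move: r2h; rewrite on nE => /(_ rh).
  split=> [j jd | dU].
    by rewrite (mid j) ?below; [congr (e < _) | ..]; lia.
  (* [Q = 0] would leave no room for [d]. In the top interval the quotient is [q], and the bound on
     [e] is then U_2 itself. *)
  case: Q mid below dP eP dU => [|q] mid below dP eP dU; first by lia.
  by rewrite (mid q) //; lia.
have [k nE] : exists k, n = k.*2 by exists n./2; rewrite even_halfK.
have half_n : n./2 = k by lia.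
rewrite half_n nE upper1_double => dP eP.
have U2_other : k.*2 %% (2 * (2 * h)) != 2 * h ->
    upper1 k.*2.-1 = k + h * uphalf (quo k).
  by rewrite modn_4h_eq_2h; apply: upper1_double_pred_nonmultiple.
have U2_L : k.*2 %% (2 * (2 * h)) = 2 * h ->
    upper1 k.*2.-1 + h = k + h * uphalf (quo k).
  move=> rE; have := modn_4h_eq_2h k; rewrite rE eqxx => /esym/andP[oN /eqP kN].
  exact: upper1_double_pred_multiple.
have below j : h * j < h * uphalf (quo k) -> j < uphalf (quo k).
  by rewrite ltn_pmul2l.
move: (@cash_win_even_middle k) below dP eP U2_other U2_L {r2h}.
move: (uphalf _) (upper1 _) (_ %% _) => Q U2n r mid below dP eP U2_other U2_L.
have Q_gt0 : 0 < Q by rewrite lt0n; apply/eqP => Q0; rewrite Q0 muln0 in dP; lia.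
(* Quotient 0: winning would require [e < k], below the middle class. *)
have poor : d < k.+1 + h - 1 -> ~~ cash_win (k.*2, d, e).
  by move=> dh; rewrite (mid 0) // ?muln0 ?muln1; lia.
have between j : 1 <= j -> k.+1 + h * j - 1 <= d < k.+1 + h * j.+1 - 1 ->
    cash_win (k.*2, d, e) = (e < k + h * j).
  move=> j0; rewrite mulnS => dj; have jQ : j < Q by apply: below; lia.
  by rewrite (mid j) // ?mulnS; lia.
have rich : k + h * Q - h <= d -> cash_win (k.*2, d, e) = (e < k + h * Q - h).
  case: Q Q_gt0 mid dP {below U2_other U2_L} => // q _ mid dP dQ.
  rewrite mulnS in dP dQ *; have -> : k + (h + h * q) - h = k + h * q by lia.
  by rewrite (mid q) // ?mulnS; lia.
split=> // [_ r_other | rE]; split=> // dQ.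
  by rewrite U2_other //; apply: rich.
(* At residue L the bound [k + h * Q - h] equals U_2, so every middle class [e] is below it. *)
by rewrite rich //; have := U2_L rE; lia.
Qed.
End Thresholds.

Theorem theorem6p6 (L n d e : nat) :
  let A := [:: 1; L; L.+1] in
  let r := n %% (2 * L) in
  4 <= L -> ~~ odd L ->
  M1 n <= d < U1 A n ->
  M2 n <= e < U2 A n ->
  [/\ (* even residues other than L *)
      ~~ odd r -> r != L ->
      [/\ d < M1 n + L./2 - 1 -> Wcash A n d e Player2,
          forall k : nat, 1 <= k ->
            M1 n + (L * k)./2 - 1 <= d < M1 n + (L * k.+1)./2 - 1 ->
            (e < M2 n + (L * k)./2 -> Wcash A n d e Player1) /\
            (M2 n + (L * k)./2 <= e -> Wcash A n d e Player2)
        & U1 A n - L./2 <= d ->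
            (e < U2 A n - L./2 -> Wcash A n d e Player1) /\
            (U2 A n - L./2 <= e -> Wcash A n d e Player2)],
      (* odd residues *)
      odd r ->
      (forall k : nat,
         M1 n + (L * k)./2 <= d < M1 n + (L * k.+1)./2 ->
         (e < M2 n + (L * k.+1)./2 - 1 -> Wcash A n d e Player1) /\
         (M2 n + (L * k.+1)./2 - 1 <= e -> Wcash A n d e Player2)) /\
      (U1 A n - L./2 <= d -> Wcash A n d e Player1)
    & r = L ->
      [/\ d < M1 n + L./2 - 1 -> Wcash A n d e Player2,
          forall k : nat, 1 <= k ->
            M1 n + (L * k)./2 - 1 <= d < M1 n + (L * k.+1)./2 - 1 ->
            (e < M2 n + (L * k)./2 -> Wcash A n d e Player1) /\
            (M2 n + (L * k)./2 <= e -> Wcash A n d e Player2)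
        & U1 A n - L./2 <= d -> Wcash A n d e Player1]].
Proof.
move=> A r L4 Leven dP eP.
have [h LE] : exists h, L = 2 * h by exists L./2; lia.
have h_gt1 : 1 < h by lia.
have half k : (2 * h * k)./2 = h * k by rewrite -mulnA mul2n doubleK.
have half1 : (2 * h)./2 = h by rewrite mul2n doubleK.
subst L; rewrite half1.
have win : cash_win h (n, d, e) -> Wcash A n d e Player1.
  by move=> w; have := cash_winP h_gt1 n d e; rewrite w.
have lose : ~~ cash_win h (n, d, e) -> Wcash A n d e Player2.
  by move=> /negbTE w; have := cash_winP h_gt1 n d e; rewrite w.
have winE t : cash_win h (n, d, e) = (e < t) ->
    (e < t -> Wcash A n d e Player1) /\ (t <= e -> Wcash A n d e Player2).
  by move=> wE; split=> et; [apply: win | apply: lose]; rewrite wE -?leqNgt.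
have [other odds resL] := cash_win_middle_class h_gt1 dP eP.
split=> [r_even r_other | r_odd | rE].
- have [poor mid rich] := other r_even r_other.
  split=> [/poor /lose // | k k1 | /rich /winE //].
  by rewrite !half => /(mid k k1) /winE.
- have [mid rich] := odds r_odd.
  split=> [k | /rich /win //].
  by rewrite !half => /(mid k) /winE.
- have [poor mid rich] := resL rE.
  split=> [/poor /lose // | k k1 | /rich /win //].
  by rewrite !half => /(mid k k1) /winE.
Qed.
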